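(* Let $\epsilon\in\{0,-1\}$ and let $(h_1,h_2,h_3,H_1,H_2,H_3):\mathbb R\to\mathbb R^6$ be a solution of the Hamiltonian system of the elastic problem $$\begin{aligned} \frac{dH_1}{ds}&=0, & \frac{dH_2}{ds}&=-H_3H_1+h_3, & \frac{dH_3}{ds}&=H_2H_1-h_2,\\ \frac{dh_1}{ds}&=H_3h_2-H_2h_3, & \frac{dh_2}{ds}&=-H_3h_1+\epsilon H_3, & \frac{dh_3}{ds}&=H_2h_1-\epsilon H_2, \end{aligned}$$ with Hamiltonian $H=\frac12(H_2^2+H_3^2)+h_1$, and let $u(s)=H_2(s)+iH_3(s)$. If $$\xi=-H_1\quad\text{and}\quad H=\epsilon ,$$ then $\psi(s,t)=u(s+\xi t)$ is a solution of the non-linear Schrödinger equation $$-i\frac{\partial\psi}{\partial t}=\frac{\partial^2\psi}{\partial s^2}+\frac12|\psi|^2\psi .$$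
   Context: The system above is the left-invariant Hamiltonian system of the regular extremals of the problem of minimizing $\frac12\int_0^L(u_2^2+u_3^2)\,ds$ over curves $\frac{dg}{ds}=g(B_1+u_2A_2+u_3A_3)$ with fixed end points in the group $G_\epsilon$ ($G_0$ the semidirect product of Euclidean 3-space with $SU_2$, $G_{-1}=SL_2(\mathbb C)$); along extremals $u_2=H_2$, $u_3=H_3$, and the projections of extremals to $G_\epsilon/SU_2$ are called elastic curves. $H_1$ and $H$ are constant along solutions of the system. *)

(* Defs.v *)
From Stdlib Require Import Reals.
From Coquelicot Require Import Coquelicot.

Open Scope R_scope.

Record elastic_solution (eps : R) (h1 h2 h3 H1 H2 H3 : R -> R) : Prop := {
  deriv_H1 : forall s, is_derive H1 s 0;
  deriv_H2 : forall s, is_derive H2 s (- H3 s * H1 s + h3 s);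
  deriv_H3 : forall s, is_derive H3 s (H2 s * H1 s - h2 s);
  deriv_h1 : forall s, is_derive h1 s (H3 s * h2 s - H2 s * h3 s);
  deriv_h2 : forall s, is_derive h2 s (- H3 s * h1 s + eps * H3 s);
  deriv_h3 : forall s, is_derive h3 s (H2 s * h1 s - eps * H2 s)
}.

Definition hamiltonian (h1 H2 H3 : R) : R := / 2 * (H2 ^ 2 + H3 ^ 2) + h1.

(* Derivative of a complex-valued function of a real variable, with C viewed
   as a normed space over R (not over itself). *)
Definition is_C_derive (f : R -> C) (x : R) (l : C) : Prop :=
  @is_derive R_AbsRing C_R_NormedModule f x l.

(* Classical solution on the whole plane of
   - i psi_t = psi_ss + (1/2) |psi|^2 psi, where s is the first argument of psi
   and t the second; the existence of the partial derivatives involved is part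
   of the definition. *)
Definition nls_solution (psi : R -> R -> C) : Prop :=
  exists psi_t psi_s psi_ss : R -> R -> C,
    (forall s t, is_C_derive (fun t' => psi s t') t (psi_t s t)) /\
    (forall s t, is_C_derive (fun s' => psi s' t) s (psi_s s t)) /\
    (forall s t, is_C_derive (fun s' => psi_s s' t) s (psi_ss s t)) /\
    (forall s t,
       (- Ci * psi_t s t
        = psi_ss s t + RtoC (/ 2) * RtoC (Cmod (psi s t) ^ 2) * psi s t)%C).

(* Main.v *)
Require Import Defs.
From Stdlib Require Import Reals Lra.
From Coquelicot Require Import Coquelicot.

Open Scope R_scope.

(** In the complex variables u = H2 + i H3 and w = h2 + i h3 the system reads

      u' = i H1 u - i w,      w' = i (h1 - eps) u,

    so, [H1] being the constant -xi, a second differentiation gives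
    u'' = - i xi u' + (h1 - eps) u.  On the level H = eps the Hamiltonian
    says exactly that h1 - eps = - |u|^2 / 2, hence

      u'' + (1/2) |u|^2 u = - i xi u'.

    The travelling wave psi (s, t) = u (s + xi t) has psi_t = xi u' and
    psi_ss = u'', which turns this second-order equation for u into the
    Schrodinger equation for psi.  Differentiation is done on real and
    imaginary parts ([is_C_derive_pair]) and carried to psi by the chain rule
    ([nls_travelling_wave]). *)

(** The pair is f (1, 0) + g (0, 1), so the rules for scaling a fixed vector
    and for sums apply. *)
Lemma is_C_derive_pair (f g : R -> R) (x a b : R) :
  is_derive f x a -> is_derive g x b ->
  is_C_derive (fun s => (f s, g s)) x (a, b).
Proof.
intros Hf Hg; unfold is_C_derive.
assert (E : forall p q : R,
  @plus C_R_NormedModule (@scal R_AbsRing C_R_NormedModule p (1, 0))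
    (@scal R_AbsRing C_R_NormedModule q (0, 1)) = (p, q)).
{ intros p q; apply injective_projections; unfold plus, scal; simpl;
    unfold plus, scal, mult; simpl; unfold mult; simpl; ring. }
rewrite <- (E a b).
apply (is_derive_ext (fun s =>
  @plus C_R_NormedModule (@scal R_AbsRing C_R_NormedModule (f s) (1, 0))
    (@scal R_AbsRing C_R_NormedModule (g s) (0, 1)))).
{ intros s; apply E. }
apply @is_derive_plus; apply @is_derive_scal_l; assumption.
Qed.

Lemma is_C_derive_comp_affine (f : R -> C) (c d x : R) (l : C) :
  is_C_derive f (c * x + d) l ->
  is_C_derive (fun y => f (c * y + d)) x (RtoC c * l)%C.
Proof.
intros Hf; unfold is_C_derive.
replace (RtoC c * l)%C with (@scal R_AbsRing C_R_NormedModule c l)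
  by apply scal_R_Cmult.
apply (@is_derive_comp R_AbsRing C_R_NormedModule f (fun y => c * y + d)).
- exact Hf.
- auto_derive; [exact I | ring].
Qed.

(** A stationary equation in the moving frame gives a travelling wave. *)
Lemma nls_travelling_wave (xi : R) (u u' u'' : R -> C)
  (Hu : forall s, is_C_derive u s (u' s))
  (Hu' : forall s, is_C_derive u' s (u'' s))
  (Heq : forall s, (- Ci * (RtoC xi * u' s)
    = u'' s + RtoC (/ 2) * RtoC (Cmod (u s) ^ 2) * u s)%C) :
  nls_solution (fun s t => u (s + xi * t)).
Proof.
assert (shift : forall v v' : R -> C, (forall s, is_C_derive v s (v' s)) ->
  forall s t, is_C_derive (fun s' => v (s' + xi * t)) s (v' (s + xi * t))).
{ intros v v' Hv s t.
  rewrite <- (Cmult_1_l (v' _)).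
  apply (is_derive_ext (fun s' => v (1 * s' + xi * t))).
  - intros s'; now rewrite Rmult_1_l.
  - apply is_C_derive_comp_affine; rewrite Rmult_1_l; apply Hv. }
exists (fun s t => Cmult (RtoC xi) (u' (s + xi * t))),
  (fun s t => u' (s + xi * t)), (fun s t => u'' (s + xi * t)).
split; [|split; [|split]].
- intros s t.
  apply (is_derive_ext (fun t' => u (xi * t' + s))).
  + intros t'; f_equal; ring.
  + apply is_C_derive_comp_affine.
    rewrite (Rplus_comm (xi * t) s); apply Hu.
- exact (shift u u' Hu).
- exact (shift u' u'' Hu').
- intros s t; apply Heq.
Qed.

Lemma Cmod_sqr (z : C) : Cmod z ^ 2 = fst z ^ 2 + snd z ^ 2.
Proof.
unfold Cmod; rewrite pow2_sqrt; [reflexivity|].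
apply Rplus_le_le_0_compat; apply pow2_ge_0.
Qed.

Theorem mainTheorem6 (eps : R) (heps : eps = 0 \/ eps = -1)
  (h1 h2 h3 H1 H2 H3 : R -> R)
  (hsol : elastic_solution eps h1 h2 h3 H1 H2 H3)
  (u : R -> C) (hu : forall s : R, u s = (RtoC (H2 s) + Ci * RtoC (H3 s))%C)
  (xi : R) (hxi : forall s : R, xi = - H1 s)
  (hH : forall s : R, hamiltonian (h1 s) (H2 s) (H3 s) = eps) :
  nls_solution (fun s t : R => u (s + xi * t)).
Proof.
destruct hsol as [_ d2 d3 _ e2 e3].
assert (HH1 : forall s, H1 s = - xi) by (intros s; rewrite (hxi s); ring).
assert (Hu : forall s, u s = (H2 s, H3 s)).
{ intros s; rewrite hu; apply injective_projections; simpl; ring. }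
(* Replacing H1 by its constant value lets u' be differentiated again. *)
assert (d2' : forall s, is_derive H2 s (xi * H3 s + h3 s)).
{ intros s; replace (xi * H3 s + h3 s) with (- H3 s * H1 s + h3 s)
    by (rewrite HH1; ring); apply d2. }
assert (d3' : forall s, is_derive H3 s (- xi * H2 s - h2 s)).
{ intros s; replace (- xi * H2 s - h2 s) with (H2 s * H1 s - h2 s)
    by (rewrite HH1; ring); apply d3. }
apply (nls_travelling_wave xi u
  (fun s => (xi * H3 s + h3 s, - xi * H2 s - h2 s))
  (fun s => (xi * (- xi * H2 s - h2 s) + (H2 s * h1 s - eps * H2 s),
             - xi * (xi * H3 s + h3 s) - (- H3 s * h1 s + eps * H3 s)))).
- intros s.
  apply (is_derive_ext (fun s => (H2 s, H3 s))).
  { intros r; symmetry; apply Hu. }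
  now apply is_C_derive_pair.
- intros s; apply is_C_derive_pair.
  + apply @is_derive_plus; [|apply e3].
    now apply is_derive_scal.
  + apply @is_derive_minus; [|apply e2].
    now apply is_derive_scal.
- intros s.
  rewrite Cmod_sqr, Hu; simpl fst; simpl snd.
  assert (Hh1 : h1 s = eps - / 2 * (H2 s ^ 2 + H3 s ^ 2)).
  { specialize (hH s); unfold hamiltonian in hH; lra. }
  apply injective_projections; simpl; rewrite Hh1; simpl; field.
Qed.
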